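(* For every integer $n\ge 2$, any essential cover of the $n$-dimensional hypercube $\{\pm 1\}^n$ consists of at least $10^{-2}\cdot n^{2/3}/(\log n)^{2/3}$ hyperplanes.
   Context: $\log$ denotes the natural logarithm. A collection of hyperplanes $h_1,\dots,h_k$ in $\mathbb{R}^n$, written $h_i=\{x\in\mathbb{R}^n : \langle v_i,x\rangle=\mu_i\}$ with $v_i=(v_{i1},\dots,v_{in})\in\mathbb{R}^n\setminus\{0\}$ and $\mu_i\in\mathbb{R}$, is an essential cover of $\{\pm1\}^n$ if: (E1) every $x\in\{\pm1\}^n$ lies in some $h_i$; (E2) for every $j\in[n]$ there is $i\in[k]$ with $v_{ij}\neq 0$; (E3) for every $i\in[k]$ there is $x\in\{\pm1\}^n$ lying in $h_i$ but in no $h_{i'}$ with $i'\neq i$. *)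

(* Defs.v *)
From HB Require Import structures.
From mathcomp Require Import all_boot all_order all_algebra.
From mathcomp Require Import all_classical all_reals all_analysis.
Set Implicit Arguments. Unset Strict Implicit. Unset Printing Implicit Defensive.
Import Order.TTheory GRing.Theory Num.Theory.
Local Open Scope ring_scope.

(* A point of the hypercube {±1}^n is encoded by a boolean vector
   b : 'I_n -> bool, with coordinate j equal to 1 if b j and -1 otherwise. *)
Definition pm1 {R : realType} (b : bool) : R := if b then 1 else -1.

Definition on_hyp {R : realType} (n : nat) (v : 'I_n -> R) (mu : R)
  (b : {ffun 'I_n -> bool}) : Prop :=
  \sum_(j < n) v j * pm1 (b j) = mu.

Definition essential_cover {R : realType} (n k : nat)
  (v : 'I_k -> 'I_n -> R) (mu : 'I_k -> R) : Prop :=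
  (forall i : 'I_k, exists j : 'I_n, v i j != 0) /\
  (forall b : {ffun 'I_n -> bool}, exists i : 'I_k, on_hyp (v i) (mu i) b) /\
  (forall j : 'I_n, exists i : 'I_k, v i j != 0) /\
  (forall i : 'I_k, exists b : {ffun 'I_n -> bool},
      on_hyp (v i) (mu i) b /\
      forall i' : 'I_k, i' != i -> ~ on_hyp (v i') (mu i') b).

(* Main.v *)
Require Import Defs.
From HB Require Import structures.
From mathcomp Require Import all_boot all_order all_algebra.
From mathcomp Require Import all_classical all_reals all_analysis.
From mathcomp Require Import zify ring lra.
Import Order.TTheory GRing.Theory Num.Theory.
Local Open Scope ring_scope.
Set Implicit Arguments. Unset Strict Implicit. Unset Printing Implicit Defensive.

(* Each v_i has at most 2k nonzero entries: starting from a point lying on h_i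
   only, the coordinates j with v_ij x_j of a given sign span a subcube in which
   the other hyperplanes cover every vertex but one, and this takes at least as
   many hyperplanes as the subcube has dimensions.

   Split the entries of v_i into logarithmic scales.  On a set A of coordinates,
   a row with at least L = O(log n) scales is rich.  The other rows are rescaled
   to Euclidean norm theta = O(sqrt(log n)) on A.  Charging the removal of a
   coordinate to the potential theta * \sum_c sqrt(size of scale c), whose total
   is O(theta k sqrt(k L)) = O(k^(3/2) log n) < n, yields a nonempty A on which
   every coordinate has total weight at most 1/2.

   Outside A, use the coordinates of a point lying only on some hyperplane that
   involves A, so that the hyperplanes not involving A are avoided.  On A, Bang's
   lemma for the rescaled rows gives a point u of [-1/2, 1/2]^A at distance at
   least theta from each of their hyperplanes.  Round u randomly to a vertex with
   mean u: each poor row is hit with probability at most exp(-theta^2/8), each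
   rich row with probability at most (3/4)^L, and a union bound contradicts the
   covering property. *)

(** * Signs, and the bound on the support of a row *)

Lemma pm1_negb (R : realType) (b : bool) : pm1 (~~ b) = - pm1 b :> R.
Proof. by case: b; rewrite /pm1 /= ?opprK. Qed.

Lemma sqr_pm1 (R : realType) (b : bool) : pm1 b * pm1 b = 1 :> R.
Proof. by case: b; rewrite /pm1 /= ?mulr1 // mulrNN mulr1. Qed.

Lemma normr_pm1 (R : realType) (b : bool) : `|pm1 b| = 1 :> R.
Proof. by case: b; rewrite /pm1 /= ?normrN normr1. Qed.

(** The sum over [T] is an iterated finite difference in #|S| directions, which kills a product of
    only #|I| affine forms. *)
Lemma alternating_prod_affine (R : realType) (I J : finType) (S : {set J})
    (a : I -> J -> R) (c : I -> R) :
  (#|I| < #|S|)%N ->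
  \sum_(T : {set J} | T \subset S)
     (-1) ^+ #|T| * \prod_i (c i + \sum_(j in T) a i j) = 0.
Proof.
move=> ltIS.
pose F (T : {set J}) i (o : option J) : R :=
  if o is Some j then (j \in T)%:R * a i j else c i.
have FE (T : {set J}) i : c i + \sum_(j in T) a i j = \sum_o F T i o.
  rewrite (bigD1 None) //=; congr (_ + _).
  rewrite (reindex_omap Some id) //=; last by case.
  rewrite [LHS]big_mkcond [RHS]big_mkcond; apply: eq_bigr => j _.
  by rewrite eqxx; case: ifP; rewrite ?mul1r ?mul0r.
under eq_bigr => T _.
  under [X in _ * X]eq_bigr => i _ do rewrite FE.
  rewrite bigA_distr_bigA mulr_sumr; over.
(* A monomial misses some [j] in [S], and toggling [j] changes the sign of its term. *)
rewrite exchange_big big1 //= => f _.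
have [j jS jf] : exists2 j, j \in S & forall i, f i != Some j.
  case: (boolP [exists (j | j \in S), [forall i, f i != Some j]]) => [|/existsPn H].
    by case/existsP => j /andP[jS /forallP jf]; exists j.
  have : (#|[set Some j | j in S]| <= #|[set f i | i : I]|)%N.
    apply: subset_leq_card; apply/fintype.subsetP => o /imsetP[j jS ->].
    have := H j; rewrite jS negb_forall => /existsP[i]; rewrite negbK => /eqP <-.
    exact: imset_f.
  rewrite card_imset; last exact: Some_inj.
  by move/leq_trans/(_ (leq_imset_card _ _)); rewrite leqNgt ltIS.
pose h (T : {set J}) := if j \in T then T :\ j else j |: T.
have hK : involutive h.
  move=> T; rewrite /h; case: (boolP (j \in T)) => jT.
    by rewrite finset.setD11 finset.setD1K.
  by rewrite finset.setU11 finset.setU1K.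
have hS T : (h T \subset S) = (T \subset S).
  rewrite /h; case: ifP => jT; last by rewrite finset.subUset finset.sub1set jS.
  by rewrite finset.subDset finset.setUC (finset.setUidPl _) // finset.sub1set.
have hj T l : l != j -> (l \in h T) = (l \in T).
  by move=> lj; rewrite /h; case: ifP; rewrite !inE ?lj // (negbTE lj).
set s := \sum_(_ | _) _.
suff : s = - s by move=> H; lra.
rewrite {1}/s (reindex_inj (inv_inj hK)) /= -sumrN.
apply: eq_big => [T|T _]; first exact: hS.
rewrite -mulNr; congr (_ * _).
  rewrite /h; case: ifP => jT; last by rewrite cardsU1 jT exprS mulN1r.
  by rewrite [in RHS](cardsD1 j) jT exprS mulN1r opprK.
apply: eq_bigr => i _; have := jf i; rewrite /F; case: (f i) => // l lj.
by rewrite hj // (contraNneq _ lj) // => ->.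
Qed.

Lemma essential_cover_support (R : realType) (n k : nat) (v : 'I_k -> 'I_n -> R)
    (mu : 'I_k -> R) (i : 'I_k) :
  essential_cover v mu -> (#|[set j | v i j != 0%R]| <= k.*2)%N.
Proof.
move=> [_ [cov [_ /(_ i) [b [bi bN]]]]].
pose x j : R := v i j * pm1 (b j).
have flipP (S : {set 'I_n}) :
    (forall T : {set 'I_n}, T \subset S -> T != finset.set0 ->
       \sum_(j in T) x j != 0) -> (#|S| <= k)%N.
  move=> HS; rewrite leqNgt; apply/negP => kS.
  (* [c l] plus the sum of [a l] over [T] is the affine form of row [l] at [y T], that is [b]
     flipped on [T]; the form of row [i] is replaced by the constant 1. For nonempty [T] the point
     [y T] leaves hyperplane [i], so another factor vanishes, and only the term of the empty set
     survives. *)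
  pose a (l : 'I_k) j := if l == i then 0 else - (2 * (v l j * pm1 (b j))) : R.
  pose c (l : 'I_k) := if l == i then 1 else \sum_j v l j * pm1 (b j) - mu l : R.
  pose y (T : {set 'I_n}) : {ffun 'I_n -> bool} := [ffun j => b j (+) (j \in T)].
  have yE l T : \sum_j v l j * pm1 (y T j) =
      \sum_j v l j * pm1 (b j) - 2 * \sum_(j in T) v l j * pm1 (b j) :> R.
    rewrite [X in _ * X]big_mkcond /= mulr_sumr -sumrB.
    apply: eq_bigr => j _; rewrite ffunE; case: (j \in T); last by rewrite addbF; ring.
    by rewrite addbT pm1_negb; ring.
  have := @alternating_prod_affine R 'I_k 'I_n S a c; rewrite card_ord => /(_ kS).
  rewrite (bigD1 finset.set0) ?finset.sub0set //= [X in _ + X]big1 => [|T /andP[TS T0]].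
    rewrite cards0 expr0 mul1r addr0 => /eqP/prodf_eq0[l _].
    rewrite big_set0 addr0 /c; have [_|li] := eqVneq l i; first by rewrite oner_eq0.
    by rewrite subr_eq0 => /eqP; exact: bN.
  have [l] := cov (y T); rewrite /on_hyp yE => lT.
  have li : l != i.
    apply/eqP => li; move: lT (HS _ TS T0); rewrite li bi /x => /eqP.
    by rewrite subr_eq addrC -subr_eq subrr eq_sym mulf_eq0 pnatr_eq0 /= => ->.
  apply/eqP; rewrite mulf_eq0; apply/orP; right; apply/prodf_eq0; exists l => //.
  by rewrite /a /c (negbTE li) -lT sumrN -mulr_sumr; apply/eqP; ring.
have pos : (#|[set j | (0 < x j)%R]| <= k)%N.
  apply: flipP => T /fintype.subsetP TP /set0Pn[j0 j0T].
  rewrite gt_eqF // (bigD1 j0) //= ltr_pwDl //.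
    by have := TP _ j0T; rewrite inE.
  by apply: sumr_ge0 => j /andP[jT _]; have := TP _ jT; rewrite inE => /ltW.
have neg : (#|[set j | (x j < 0)%R]| <= k)%N.
  apply: flipP => T /fintype.subsetP TP /set0Pn[j0 j0T].
  rewrite lt_eqF // (bigD1 j0) //= ltr_nwDl //.
    by have := TP _ j0T; rewrite inE.
  by apply: sumr_le0 => j /andP[jT _]; have := TP _ jT; rewrite inE => /ltW.
rewrite -addnn; apply: leq_trans (leq_add pos neg); rewrite -cardsUI.
apply: leq_trans (leq_addr _ _); apply: subset_leq_card.
apply/fintype.subsetP => j; rewrite !inE /x => vj.
rewrite orbC -neq_lt mulf_neq0 // /pm1; by case: (b j); rewrite ?oppr_eq0 oner_eq0.
Qed.

(** * Bang's lemma and random rounding with prescribed mean *)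

(* The signs maximise [|u|^2 - 2 \sum_i e_i m_i], where [u = \sum_i e_i w_i];
   comparing with the vector obtained by flipping [e_i] gives the inequality. *)
Lemma bang_signs (R : realType) (I J : finType) (w : I -> J -> R) (m : I -> R) :
  exists e : {ffun I -> bool}, forall i,
    \sum_j w i j ^+ 2 <=
    pm1 (e i) * (\sum_j w i j * (\sum_l pm1 (e l) * w l j) - m i).
Proof.
pose u (e : {ffun I -> bool}) j : R := \sum_l pm1 (e l) * w l j.
pose q (e : {ffun I -> bool}) : R := \sum_j u e j ^+ 2 - 2 * \sum_l pm1 (e l) * m l.
case: (@Order.TotalTheory.arg_maxP _ _ _ [ffun=> true] xpredT q) => // e _ emax.
exists e => i.
pose e' : {ffun I -> bool} := [ffun l => e l (+) (l == i)].
have e'E (z : I -> R) : \sum_l pm1 (e' l) * z l = \sum_l pm1 (e l) * z l - 2 * (pm1 (e i) * z i).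
  rewrite (bigD1 i) //= [in RHS](bigD1 i) //= ffunE eqxx addbT pm1_negb.
  rewrite (eq_bigr (fun l => pm1 (e l) * z l)) => [|l li]; first by ring.
  by rewrite ffunE (negbTE li) addbF.
have : q e' <= q e by exact: emax.
rewrite /q e'E.
have -> : \sum_j u e' j ^+ 2 = \sum_j u e j ^+ 2
    - 4 * (pm1 (e i) * \sum_j w i j * u e j) + 4 * \sum_j w i j ^+ 2.
  rewrite !mulr_sumr -sumrB -big_split /=; apply: eq_bigr => j _.
  rewrite /u e'E; set s := \sum_l _.
  have := sqr_pm1 R (e i); set p := pm1 _ => pp.
  have -> : w i j ^+ 2 = p * p * w i j ^+ 2 by rewrite pp mul1r.
  ring.
rewrite [X in _ -> _ <= X]mulrBr /= -/(u e); set s := \sum_j _ * _.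
by rewrite /u -/s; lra.
Qed.

(* The probability of [b] under the product measure on the cube whose mean is [u]. *)
Definition biased_prob (R : realType) (J : finType) (u : J -> R)
  (b : {ffun J -> bool}) : R := \prod_j ((1 + u j * pm1 (b j)) / 2).

Lemma biased_prob_ge0 (R : realType) (J : finType) (u : J -> R) b :
  (forall j, `|u j| <= 1) -> 0 <= biased_prob u b.
Proof.
move=> u1; apply: prodr_ge0 => j _; have := u1 j; rewrite ler_norml => /andP[? ?].
by case: (b j); rewrite /pm1; lra.
Qed.

Lemma sum_biased_prob (R : realType) (J : finType) (u : J -> R) (g : J -> bool -> R) :
  \sum_b biased_prob u b * \prod_j g j (b j) =
  \prod_j ((1 + u j) / 2 * g j true + (1 - u j) / 2 * g j false).
Proof.
under [LHS]eq_bigr => b _ do rewrite -big_split /=.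
rewrite -(bigA_distr_bigA (fun j c => (1 + u j * pm1 c) / 2 * g j c)).
apply: eq_bigr => j _; rewrite big_bool /pm1 /=; ring.
Qed.

Lemma sum_biased_prob1 (R : realType) (J : finType) (u : J -> R) :
  \sum_b biased_prob u b = 1.
Proof.
have := sum_biased_prob u (fun _ _ => 1).
rewrite [X in _ = X -> _]big1 => [<-|j _]; last by field.
by apply: eq_bigr => b _; rewrite big1 ?mulr1.
Qed.

(** A coordinate of mean 1 or -1 is deterministic; this pins the rounding to a chosen vertex outside
    the light set. *)
Lemma biased_prob_neq0 (R : realType) (J : finType) (u : J -> R) b (c : bool) j :
  u j = pm1 c -> biased_prob u b != 0 -> b j = c.
Proof.
move=> uj; apply: contraNeq => bc; apply/eqP; rewrite /biased_prob (bigD1 j) //= uj.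
have -> : b j = ~~ c by move: bc; case: (b j); case: c {uj}.
by rewrite pm1_negb mulrN sqr_pm1 subrr !mul0r.
Qed.

(** From exp(-x) >= 1 - x one gets (1 - x) exp(x) <= 1, while (1 - x)(1 + x + 2x^2) = 1 + x^2 (1 -
    2x) >= 1. *)
Lemma expR_le_quad (R : realType) (x : R) :
  x <= 1 / 2 -> expR x <= 1 + x + 2 * x ^+ 2.
Proof.
move=> x2; have := expR_ge1Dx (- x); rewrite expRN => H.
have e0 := expR_gt0 x.
have H1 : (1 - x) * expR x <= 1.
  have := ler_wpM2r (ltW e0) H; rewrite mulVf //; exact: lt0r_neq0.
nra.
Qed.

(* Exponential Markov inequality with parameter 1/4. *)
Lemma biased_prob_tail (R : realType) (J : finType) (u w : J -> R) (c e : R) :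
  (forall j, `|u j| <= 1) -> `|e| = 1 ->
  (forall j, w j != 0 -> `|u j| <= 1 / 2 /\ `|w j| <= 1 / 2) ->
  \sum_j w j ^+ 2 <= e * (\sum_j w j * u j - c) ->
  \sum_(b : {ffun J -> bool} | \sum_j w j * pm1 (b j) == c) biased_prob u b <=
  expR (- (\sum_j w j ^+ 2) / 8).
Proof.
move=> u1 e1 wu; set W := \sum_j w j ^+ 2 => We.
pose g j (a : bool) : R := expR (e * w j * (u j - pm1 a) / 4).
have e2 : e * e = 1 by rewrite -expr2 -real_normK ?num_real // e1 expr1n.
have gE (b : {ffun J -> bool}) :
    \prod_j g j (b j) = expR (e * (\sum_j w j * u j - \sum_j w j * pm1 (b j)) / 4).
  rewrite -expR_sum; congr expR; rewrite -mulr_suml -sumrB mulr_sumr; congr (_ / _).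
  by apply: eq_bigr => j _; ring.
(* On the event, the last hypothesis makes the exponent in [gE] at least W/4. *)
have le1 : \sum_(b : {ffun J -> bool} | \sum_j w j * pm1 (b j) == c) biased_prob u b
    <= expR (- W / 4) * \sum_b biased_prob u b * \prod_j g j (b j).
  rewrite mulr_sumr big_mkcond /=; apply: ler_sum => b _.
  rewrite gE; have p0 := biased_prob_ge0 b u1; case: ifP => [/eqP ->|_].
    rewrite mulrCA -expRD ler_peMr // -[X in X <= _]expR0 ler_expR.
    by lra.
  by rewrite mulr_ge0 ?expR_ge0 // mulr_ge0 ?expR_ge0.
have le2 : \sum_b biased_prob u b * \prod_j g j (b j) <= expR (W / 8).
  rewrite sum_biased_prob /W mulr_suml expR_sum.
  apply: ler_prod => j _; have := u1 j; rewrite ler_norml => /andP[ul ur].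
  apply/andP; split.
    by apply: addr_ge0; apply: mulr_ge0; rewrite ?expR_ge0 //; lra.
  have [w0|w0] := eqVneq (w j) 0.
    by rewrite /g w0 !(mulr0, mul0r) expr0n !mul0r expR0; lra.
  have [uj wj] := wu _ w0.
  have bnd a : e * w j * (u j - pm1 a) / 4 <= 1 / 2.
    apply: le_trans (ler_norm _) _; rewrite !normrM e1 mul1r.
    have le3 : `|u j - pm1 a| <= 3 / 2.
      by apply: le_trans (ler_normB _ _) _; rewrite normr_pm1; lra.
    have := ler_pM (normr_ge0 _) (normr_ge0 _) wj le3.
    rewrite [`|4^-1|]ger0_norm; last by lra.
    lra.
  have := expR_ge1Dx (w j ^+ 2 / 8); apply: le_trans.
  have H1 := expR_le_quad (bnd true); have H2 := expR_le_quad (bnd false).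
  have pt : 0 <= (1 + u j) / 2 by lra.
  have pf : 0 <= (1 - u j) / 2 by lra.
  apply: le_trans (lerD (ler_wpM2l pt H1) (ler_wpM2l pf H2)) _; rewrite /pm1 /=.
  (* The linear terms cancel because [u j] is the mean; the quadratic ones add up to w^2 (1 - u^2) /
     8. *)
  rewrite -subr_ge0 [X in 0 <= X](_ : _ = (w j * u j) ^+ 2 / 8); last first.
    have -> : w j ^+ 2 = e * e * w j ^+ 2 by rewrite e2 mul1r.
    have -> : (w j * u j) ^+ 2 = e * e * (w j * u j) ^+ 2 by rewrite e2 mul1r.
    by field.
  by rewrite divr_ge0 ?sqr_ge0.
apply: le_trans le1 _; apply: le_trans (ler_wpM2l (expR_ge0 _) le2) _.
by rewrite -expRD ler_expR; lra.
Qed.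

(** * Lacunary weights *)

Definition lacunary (R : realType) (J : finType) (v : J -> R) (S : {set J}) : Prop :=
  (forall j, j \in S -> v j != 0) /\
  (forall i j, i \in S -> j \in S -> i != j ->
     2 * `|v i| <= `|v j| \/ 2 * `|v j| <= `|v i|).

Lemma lacunary_sub (R : realType) (J : finType) (v : J -> R) (S T : {set J}) :
  T \subset S -> lacunary v S -> lacunary v T.
Proof. by move=> /fintype.subsetP TS [h1 h2]; split=> [j /TS|i j /TS iS /TS]; auto. Qed.

(** Induction on the size: the weights other than the largest, [v j], sum to less than |v j|, so the
    total is below 2 |v j|. *)
Lemma lacunary_sum (R : realType) (J : finType) (v : J -> R) (S : {set J}) (M : R) :
  0 < M -> lacunary v S -> (forall j, j \in S -> 2 * `|v j| <= M) ->
  \sum_(j in S) `|v j| < M.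
Proof.
have [m] := ubnP #|S|; elim: m S M => // m IHm S M Sm M0 lac SM.
have [->|[j0 j0S]] := set_0Vmem S; first by rewrite big_set0.
case: (@Order.TotalTheory.arg_maxP _ _ _ j0 (mem S) (fun j => `|v j|)) => // j jmS jmax.
have jS : j \in S by [].
rewrite (big_setD1 j) //=.
have : \sum_(i in S :\ j) `|v i| < `|v j|.
  apply: IHm.
  - by move: Sm; rewrite (cardsD1 j) jS.
  - by rewrite normr_gt0; case: lac => + _; apply.
  - by apply: lacunary_sub lac; rewrite subsetDl.
  move=> i; rewrite !inE => /andP[ij iS].
  have vj : 0 < `|v j| by rewrite normr_gt0; case: lac => + _; apply.
  have ijle : `|v i| <= `|v j| by exact: jmax.
  by case: lac => _ /(_ i j iS jS ij) []; lra.
have := SM j jS; lra.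
Qed.

(* The weights on [S] are dissociated: once the coordinates outside [S] are
   fixed, at most one choice on [S] meets the hyperplane. *)
Lemma biased_prob_lacunary (R : realType) (J : finType) (u v : J -> R) (c : R)
    (S : {set J}) :
  (forall j, `|u j| <= 1) -> lacunary v S ->
  (forall j, j \in S -> `|u j| <= 1 / 2) ->
  \sum_(b : {ffun J -> bool} | \sum_j v j * pm1 (b j) == c) biased_prob u b <=
  expR (- #|S|%:R / 4).
Proof.
move=> u1 lac uS.
(* [r] erases the coordinates in [S], and [biased_prob u'] is the law of [r b]. *)
pose r (b : {ffun J -> bool}) : {ffun J -> bool} := [ffun j => (j \in S) || b j].
pose u' j := if j \in S then 1 else u j.
have u'1 j : `|u' j| <= 1 by rewrite /u'; case: ifP; rewrite ?normr1.
have rinj : {in [pred b : {ffun J -> bool} | \sum_j v j * pm1 (b j) == c] &, injective r}.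
  move=> b b'; rewrite !inE => /eqP hb /eqP hb' /ffunP rb.
  have off j : j \notin S -> b j = b' j.
    by move=> jS; have := rb j; rewrite !ffunE (negbTE jS).
  case: (pickP (fun j => b j != b' j)) => [j0 bj0|bb']; last first.
    by apply/ffunP => j; apply/eqP/negbFE; exact: bb'.
  (* The two points differ exactly on [D], so the signed sum of the weights over [D] is zero,
     although its largest term outweighs all the others together. *)
  pose D := [set j in S | b j != b' j].
  have DS : D \subset S by apply/fintype.subsetP => j; rewrite inE => /andP[].
  have j0D : j0 \in D by rewrite inE bj0 andbT; apply: contraNT bj0 => /off ->.
  case: (@Order.TotalTheory.arg_maxP _ _ _ j0 (mem D) (fun j => `|v j|)) => // j jmD jmax.
  have jD : j \in D by [].
  have lacD := lacunary_sub DS lac.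
  have vj : 0 < `|v j| by rewrite normr_gt0; case: lacD => + _; apply.
  have small : \sum_(i in D :\ j) `|v i| < `|v j|.
    apply: lacunary_sum => //.
      by apply: lacunary_sub lacD; rewrite subsetDl.
    move=> i; rewrite in_setD1 => /andP[ij iD].
    have ijle : `|v i| <= `|v j| by exact: jmax.
    by case: lacD => _ /(_ i j iD jD ij) []; lra.
  have bneg i : i \in D -> b i = ~~ b' i.
    by rewrite inE => /andP[_]; case: (b i); case: (b' i).
  have : \sum_(i in D) v i * pm1 (b i) = 0.
    have : \sum_i (v i * pm1 (b i) - v i * pm1 (b' i)) = 0.
      by rewrite sumrB hb hb' subrr.
    rewrite (bigID (mem D)) /= [X in _ + X]big1 => [|i]; last first.
      rewrite inE negb_and negbK => /orP[/off ->|/eqP ->]; exact: subrr.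
    rewrite addr0 (eq_bigr (fun i => 2 * (v i * pm1 (b i)))) => [|i iD]; last first.
      by rewrite (bneg i iD) pm1_negb; ring.
    by rewrite -mulr_sumr => /eqP; rewrite mulf_eq0 pnatr_eq0 /= => /eqP.
  rewrite (big_setD1 j) //= => /eqP; rewrite addr_eq0 => /eqP /(congr1 Num.norm).
  rewrite normrM normr_pm1 mulr1 normrN => E.
  have := ler_norm_sum (enum (D :\ j)) (fun i => v i * pm1 (b i)) xpredT.
  rewrite !big_enum /= -E; under eq_bigr do rewrite normrM normr_pm1 mulr1.
  by move/le_lt_trans/(_ small); rewrite ltxx.
(* Each coordinate in [S] contributes a factor at most (1 + 1/2) / 2 = 3/4 <= exp(-1/4). *)
have prle b : biased_prob u b <= expR (- #|S|%:R / 4) * biased_prob u' (r b).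
  have -> : expR (- #|S|%:R / 4) = \prod_(j in S) expR (- (4^-1)) :> R.
    by rewrite prodr_const -expRM_natl mulrN mulNr.
  rewrite /biased_prob.
  rewrite [X in _ <= X * _]big_mkcond -big_split /=; apply: ler_prod => j _.
  have := u1 j; rewrite ler_norml => /andP[ul ur].
  apply/andP; split; first by rewrite /pm1; case: (b j); lra.
  rewrite /u' ffunE; case: ifPn => jS /=; last by rewrite mul1r.
  have := uS j jS; rewrite ler_norml => /andP[ul' ur'].
  have := expR_ge1Dx (- (4^-1) : R).
  by rewrite /pm1; case: (b j); lra.
apply: le_trans (ler_sum _ (fun b _ => prle b)) _.
rewrite -mulr_sumr -[X in _ <= X]mulr1 ler_wpM2l ?expR_ge0 //.
rewrite -(sum_biased_prob1 u') -(big_imset _ rinj) /=.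
set H := [set r b | b in _]; rewrite [X in _ <= X](bigID (mem H)) /=.
rewrite lerDl; apply: sumr_ge0 => b _; exact: biased_prob_ge0.
Qed.

(** * Logarithmic scales and the square-root potential *)

(** Nonzero entries of one scale have ratio at most e <= 4; if the scales differ by at least 2, the
    ratio is at least e >= 2. Zero entries get a default scale and are discarded in [level]. *)
Definition log_scale (R : realType) (J : finType) (v : J -> R) (j : J) : int :=
  Num.floor (ln `|v j|).

(* An element of [J] standing for the class of [j] under equality of scales, so
   that the scales are indexed by a finite type. *)
Definition scale_rep (R : realType) (J : finType) (v : J -> R) (j : J) : J :=
  odflt j [pick i | log_scale v i == log_scale v j].

Definition level (R : realType) (J : finType) (v : J -> R) (A : {set J}) (c : J) : {set J} :=
  [set j in A | (v j != 0) && (scale_rep v j == c)].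

Definition scales (R : realType) (J : finType) (v : J -> R) (A : {set J}) : {set J} :=
  [set c | level v A c != finset.set0].

Definition potential (R : realType) (J : finType) (v : J -> R) (A : {set J}) : R :=
  \sum_c Num.sqrt #|level v A c|%:R.

Section Scales.
Context {R : realType} {J : finType}.
Implicit Types (v : J -> R) (A B : {set J}) (i j c : J).

Lemma log_scale_rep v j : log_scale v (scale_rep v j) = log_scale v j.
Proof. by rewrite /scale_rep; case: pickP => [i /eqP|]. Qed.

Lemma eq_scale_rep v i j :
  log_scale v i = log_scale v j -> scale_rep v i = scale_rep v j.
Proof.
rewrite /scale_rep => ->; case: pickP => // /(_ j); by rewrite eqxx.
Qed.

Lemma scale_rep_comparable v i j : v i != 0 -> v j != 0 ->
  scale_rep v i = scale_rep v j -> `|v i| <= 4 * `|v j|.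
Proof.
rewrite -!normr_gt0 => vi vj /(congr1 (log_scale v)); rewrite !log_scale_rep => e.
have /andP[_ hi] := floor_itv (ln `|v i|); have /andP[hj _] := floor_itv (ln `|v j|).
rewrite -[`|v i|]lnK // -[X in _ <= _ * X]lnK //.
apply: (@le_trans _ _ (expR (1 + ln `|v j|))).
  by rewrite ler_expR; move: hi hj; rewrite -/(log_scale v i) -/(log_scale v j) e intrD; lra.
rewrite expRD ler_wpM2r ?expR_ge0 //.
(* The quadratic bound gives exp(1/2) <= 2, hence e <= 4. *)
have -> : (1 : R) = 1 / 2 + 1 / 2 by field.
have := @expR_le_quad R (1 / 2) (lexx _); have := expR_ge0 (1 / 2 : R).
rewrite expRD; nra.
Qed.

Lemma log_scale_lt_double v i j : v i != 0 -> v j != 0 ->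
  log_scale v i + 2 <= log_scale v j -> 2 * `|v i| <= `|v j|.
Proof.
rewrite -!normr_gt0 => vi vj; rewrite -(ler_int R) intrD => e.
have /andP[_ hi] := floor_itv (ln `|v i|); have /andP[hj _] := floor_itv (ln `|v j|).
rewrite -[X in _ * X <= _]lnK // -[X in _ <= X]lnK //.
apply: (@le_trans _ _ (expR (1 + ln `|v i|))); last first.
  by rewrite ler_expR; move: hi hj; rewrite -/(log_scale v i) -/(log_scale v j) intrD; lra.
by rewrite expRD ler_wpM2r ?expR_ge0 //; have := @expR_ge1Dx R 1.
Qed.

(** Adjacent scales can hold nearly equal entries, whereas distinct scales of equal parity are at
    least 2 apart. *)
Lemma log_scale_parity v i j : v i != 0 -> v j != 0 ->
  log_scale v i != log_scale v j -> (log_scale v i = log_scale v j %[mod 2])%Z ->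
  2 * `|v i| <= `|v j| \/ 2 * `|v j| <= `|v i|.
Proof.
move=> vi vj ne par.
have : log_scale v i + 2 <= log_scale v j \/ log_scale v j + 2 <= log_scale v i by lia.
by case=> /log_scale_lt_double; [left|right]; auto.
Qed.

Lemma levelS v A B c : A \subset B -> level v A c \subset level v B c.
Proof.
move=> /fintype.subsetP AB; apply/fintype.subsetP => j.
by rewrite !inE => /andP[/AB -> ->].
Qed.

Lemma scalesS v A B : A \subset B -> scales v A \subset scales v B.
Proof.
move=> AB; apply/fintype.subsetP => c; rewrite !inE -!card_gt0 => h.
exact: leq_trans h (subset_leq_card (levelS v c AB)).
Qed.

Lemma potential_ge0 v A : 0 <= potential v A.
Proof. by apply: sumr_ge0 => c _; exact: sqrtr_ge0. Qed.

Lemma potentialS v A B : A \subset B -> potential v A <= potential v B.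
Proof.
move=> AB; apply: ler_sum => c _.
by rewrite ler_sqrt ?ler0n // ler_nat subset_leq_card ?levelS.
Qed.

(* By AM-GM, [2 sqrt s <= s / t + t] for each of the nonempty levels. *)
Lemma potential_le v A (t : R) : 0 < t ->
  2 * potential v A <= #|[set j | v j != 0%R]|%:R / t + #|scales v A|%:R * t.
Proof.
move=> t0; rewrite mulr_sumr.
have sz : (\sum_c #|level v A c| <= #|[set j | v j != 0%R]|)%N.
  rewrite -sum1_card [X in (_ <= X)%N](partition_big (scale_rep v) xpredT) //=.
    apply: leq_sum => c _; rewrite -sum1_card big_mkcond [X in (_ <= X)%N]big_mkcond /=.
    apply: leq_sum => j _; rewrite !inE.
  by case: (j \in A); case: (v j != 0); case: (_ == c).
apply: (@le_trans _ _ (\sum_c (#|level v A c|%:R / t + (c \in scales v A)%:R * t))).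
  apply: ler_sum => c _; rewrite inE -card_gt0.
  set s := #|level v A c|; have [s0|s0] := posnP s.
    by rewrite s0 sqrtr0 mulr0 !mul0r addr0.
  have := sqr_sqrtr (ler0n R s); set q := Num.sqrt _ => <-.
  rewrite mul1r -subr_ge0 [X in 0 <= X](_ : _ = (q - t) ^+ 2 / t); last first.
    by field; rewrite gt_eqF.
  by rewrite divr_ge0 ?sqr_ge0 // ltW.
rewrite big_split /= -!mulr_suml lerD //.
  by rewrite ler_wpM2r ?invr_ge0 ?(ltW t0) // -natr_sum ler_nat.
by rewrite -natr_sum -sum1_card [X in _ <= X%:R * _]big_mkcond.
Qed.

(** Pick one entry per nonempty level; one of the two parity classes of scales contains at least [L]
    of the picks. *)
Lemma exists_lacunary v A L : (L.*2 <= #|scales v A|)%N ->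
  exists S : {set J}, [/\ S \subset A, lacunary v S & (L <= #|S|)%N].
Proof.
move=> hL.
pose rep c := odflt c [pick j in level v A c].
have repP c : c \in scales v A -> rep c \in level v A c.
  rewrite inE => /set0Pn[j jc]; rewrite /rep; case: pickP => //= /(_ j).
  by rewrite jc.
have repA c : c \in scales v A -> rep c \in A by move=> /repP; rewrite inE => /andP[].
have rep0 c : c \in scales v A -> v (rep c) != 0.
  by move=> /repP; rewrite inE => /and3P[].
have repK c : c \in scales v A -> scale_rep v (rep c) = c.
  by move=> /repP; rewrite inE => /and3P[_ _ /eqP].
pose P c := (log_scale v (rep c) %% 2)%Z == 0.
have main (K : {set J}) : K \subset scales v A ->
    (forall c d, c \in K -> d \in K ->
       (log_scale v (rep c) = log_scale v (rep d) %[mod 2])%Z) ->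
    (L <= #|K|)%N -> exists S : {set J}, [/\ S \subset A, lacunary v S & (L <= #|S|)%N].
  move=> /fintype.subsetP KS Kpar LK; exists [set rep c | c in K]; split.
  - by apply/fintype.subsetP => j /imsetP[c /KS cS ->]; exact: repA.
  - split=> [j /imsetP[c /KS cS ->]|i j /imsetP[c cK ->] /imsetP[d dK ->] ne].
      exact: rep0.
    apply: log_scale_parity; rewrite ?rep0 ?KS //; last exact: Kpar.
    apply: contraNneq ne => /eq_scale_rep; rewrite !repK ?KS // => ->; exact: eqxx.
  - rewrite card_in_imset // => c d cK dK /(congr1 (scale_rep v)).
    by rewrite !repK ?KS.
have [h|h] := leqP L #|[set c in scales v A | P c]|.
  apply: (main _ _ _ h).
    by apply/fintype.subsetP => c; rewrite inE => /andP[].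
  by move=> c d; rewrite !inE => /andP[_ /eqP ->] /andP[_ /eqP ->].
apply: (main [set c in scales v A | ~~ P c]).
- by apply/fintype.subsetP => c; rewrite inE => /andP[].
- by move=> c d; rewrite !inE /P => /andP[_ hc] /andP[_ hd]; lia.
- have : (#|scales v A| <= #|[set c in scales v A | P c]| + #|[set c in scales v A | ~~ P c]|)%N.
    rewrite -cardsUI; apply: leq_trans (leq_addr _ _); apply: subset_leq_card.
    by apply/fintype.subsetP => c; rewrite !inE => ->; case: (P c).
  by move: hL h; rewrite -addnn; lia.
Qed.

(** If the level of [j] has s elements, its entries are at least |v j| / 4 in modulus, so the ratio
    on the left is at most 4 / sqrt s. Removing [j] lowers the potential by at least sqrt s - sqrt
    (s - 1) >= 1 / (2 sqrt s). *)
Lemma potential_drop v A j : j \in A ->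
  `|v j| / Num.sqrt (\sum_(i in A) v i ^+ 2) <= 8 * (potential v A - potential v (A :\ j)).
Proof.
move=> jA; have [vj|vj] := eqVneq (v j) 0.
  by rewrite vj normr0 mul0r mulr_ge0 // subr_ge0 potentialS // subsetDl.
pose c := scale_rep v j; pose s := #|level v A c|.
have jc : j \in level v A c by rewrite inE jA vj eqxx.
have s0 : (0 < s)%N by rewrite /s (cardsD1 j) jc.
have q0 : 0 < Num.sqrt s%:R :> R by rewrite sqrtr_gt0 ltr0n.
have Dc : #|level v (A :\ j) c| = s.-1.
  rewrite /s (cardsD1 j (level v A c)) jc /=; apply: eq_card => i.
  by rewrite !inE -andbA.
have drop : Num.sqrt s%:R - Num.sqrt s.-1%:R <= potential v A - potential v (A :\ j).
  rewrite /potential -sumrB (bigD1 c) //= Dc lerDl; apply: sumr_ge0 => d _.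
  by rewrite subr_ge0 ler_sqrt ?ler0n // ler_nat subset_leq_card ?levelS ?subsetDl.
have half : 1 / (2 * Num.sqrt s%:R) <= Num.sqrt s%:R - Num.sqrt s.-1%:R :> R.
  have e1 : Num.sqrt s%:R ^+ 2 = s%:R :> R by rewrite sqr_sqrtr ?ler0n.
  have e2 : Num.sqrt s.-1%:R ^+ 2 = s.-1%:R :> R by rewrite sqr_sqrtr ?ler0n.
  have e3 : s%:R = s.-1%:R + 1 :> R by rewrite natr1 prednK.
  have p0 := sqrtr_ge0 (s.-1%:R : R).
  rewrite ler_pdivrMr ?mulr_gt0 //; nra.
have norm : Num.sqrt s%:R * `|v j| / 4 <= Num.sqrt (\sum_(i in A) v i ^+ 2).
  rewrite -[X in X <= _]ger0_norm; last by rewrite divr_ge0 // mulr_ge0 // sqrtr_ge0.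
  rewrite -sqrtr_sqr; apply: ler_wsqrtr.
  rewrite (bigID (mem (level v A c))) /=; apply: ler_wpDr.
    by apply: sumr_ge0 => i _; exact: sqr_ge0.
  rewrite (eq_bigl (mem (level v A c))) => [|i]; last first.
    by rewrite /= inE; case: (i \in A).
  apply: (@le_trans _ _ (\sum_(i in level v A c) (`|v j| / 4) ^+ 2)).
    by rewrite sumr_const -/s -mulrA exprMn sqr_sqrtr ?ler0n // mulr_natl.
  apply: ler_sum => i; rewrite inE => /and3P[_ vi /eqP ic].
  have := scale_rep_comparable vj vi (esym ic).
  rewrite -[X in _ -> _ <= X]real_normK ?num_real // => h.
  rewrite ler_pXn2r ?nnegrE ?divr_ge0 //; lra.
have vj0 : 0 < `|v j| by rewrite normr_gt0.
have N0 : 0 < Num.sqrt (\sum_(i in A) v i ^+ 2).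
  by apply: lt_le_trans norm; rewrite divr_gt0 ?mulr_gt0.
rewrite ler_pdivrMr //.
have h1 : 4 / Num.sqrt s%:R <= 8 * (potential v A - potential v (A :\ j)).
  apply: (@le_trans _ _ (8 * (1 / (2 * Num.sqrt s%:R)))); last by rewrite ler_wpM2l //; lra.
  rewrite le_eqVlt; apply/orP; left; apply/eqP; field; exact: lt0r_neq0.
apply: le_trans (ler_wpM2r (ltW N0) h1).
apply: le_trans (ler_wpM2l _ norm); last by rewrite divr_ge0 // ltW.
rewrite le_eqVlt; apply/orP; left; apply/eqP; field; exact: lt0r_neq0.
Qed.
End Scales.

(** * Choice of the light coordinates *)

Lemma exists_light_coordinates (R : realType) (I J : finType) (v : I -> J -> R)
    (s L : nat) (theta : R) :
  (0 < s)%N -> (0 < L)%N -> 0 <= theta ->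
  (forall i, #|[set j | v i j != 0%R]| <= s.*2)%N ->
  32 * #|I|%:R * (theta * (Num.sqrt s%:R * Num.sqrt L%:R)) < #|J|%:R ->
  exists A : {set J}, A != finset.set0 /\ forall j, j \in A ->
    \sum_(i | (#|scales (v i) A| < L.*2)%N)
      theta * (`|v i j| / Num.sqrt (\sum_(l in A) v i l ^+ 2)) <= 1 / 2.
Proof.
move=> s0 L0 th0 supp small.
have a0 : 0 < Num.sqrt s%:R :> R by rewrite sqrtr_gt0 ltr0n.
have b0 : 0 < Num.sqrt L%:R :> R by rewrite sqrtr_gt0 ltr0n.
have a2 : Num.sqrt s%:R ^+ 2 = s%:R :> R by rewrite sqr_sqrtr ?ler0n.
have b2 : Num.sqrt L%:R ^+ 2 = L%:R :> R by rewrite sqr_sqrtr ?ler0n.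
set a := Num.sqrt s%:R in a0 a2 small; set b := Num.sqrt L%:R in b0 b2 small.
pose B := 16 * (theta * (a * b)).
pose poor A i := (#|scales (v i) A| < L.*2)%N.
(* Giving rich rows the cap [B] keeps [phi] from increasing when a removal turns a rich row into a
   poor one. *)
pose phi A i := if poor A i then 8 * theta * potential (v i) A else B.
have B0 : 0 <= B by rewrite !mulr_ge0 // ltW.
have phi0 A i : 0 <= phi A i.
  by rewrite /phi; case: ifP => // _; rewrite !mulr_ge0 // potential_ge0.
have phiB A i : phi A i <= B.
  rewrite /phi; case: ifP => // /ltnW pA.
  (* The choice t = a / b balances the two terms of [potential_le]: a support of at most 2s and
     fewer than 2L scales give 4ab in all. *)
  have t0 : 0 < a / b by rewrite divr_gt0.
  have := potential_le (v i) A t0; set p := potential _ _ => le1.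
  have le2 : 2 * p <= s.*2%:R / (a / b) + L.*2%:R * (a / b).
    apply: le_trans le1 _; apply: lerD; apply: ler_wpM2r;
      by rewrite ?invr_ge0 ?(ltW t0) // ler_nat ?supp.
  have le3 : p <= 2 * (a * b).
    move: le2; rewrite -!muln2 !natrM -a2 -b2.
    have -> : a ^+ 2 * 2 / (a / b) + b ^+ 2 * 2 * (a / b) = 4 * (a * b) :> R.
      by field; rewrite !gt_eqF.
    lra.
  by have := ler_wpM2l th0 le3; rewrite /B -mulrA; lra.
have phi_drop (A : {set J}) i j : j \in A -> poor A i ->
    theta * (`|v i j| / Num.sqrt (\sum_(l in A) v i l ^+ 2)) <= phi A i - phi (A :\ j) i.
  move=> jA pA; have pA' : poor (A :\ j) i.
    by apply: leq_ltn_trans pA; rewrite subset_leq_card // scalesS // subsetDl.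
  rewrite /phi pA pA'; have := ler_wpM2l th0 (potential_drop (v i) jA); lra.
have phiS (A : {set J}) i j : phi (A :\ j) i <= phi A i.
  rewrite {2}/phi; case: ifPn => [pA|_]; last exact: phiB.
  have pA' : poor (A :\ j) i.
    by apply: leq_ltn_trans pA; rewrite subset_leq_card // scalesS // subsetDl.
  by rewrite /phi pA' ler_wpM2l ?mulr_ge0 // potentialS // subsetDl.
(* A minimiser of [F] is nonempty because [F [set: J] < 0 <= F set0]; as removing
   [j] does not decrease [F], the weights at [j] sum to at most 1/2. *)
pose F (A : {set J}) : R := 2 * \sum_i phi A i - #|A|%:R.
case: (@Order.TotalTheory.arg_minP _ _ _ [set: J] xpredT F) => // A _ Amin.
have minF A' : F A <= F A' by exact: Amin.
exists A; split.
  apply/eqP => A0; have := minF [set: J]; rewrite /F (_ : #|A| = 0%N) ?A0 ?cards0 // -A0 cardsT.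
  have h1 : 0 <= \sum_i phi A i by apply: sumr_ge0 => i _; exact: phi0.
  have h2 : \sum_i phi [set: J] i <= #|I|%:R * B.
    by rewrite mulr_natl -sumr_const; apply: ler_sum => i _; exact: phiB.
  by move: small h2; rewrite /B; lra.
move=> j jA; have := minF (A :\ j); rewrite /F (cardsD1 j A) jA natrD -[true%:R]/(1 : R).
have : \sum_(i | poor A i) theta * (`|v i j| / Num.sqrt (\sum_(l in A) v i l ^+ 2)) <=
    \sum_i phi A i - \sum_i phi (A :\ j) i.
  rewrite -sumrB [X in _ <= X](bigID (poor A)) /=; apply: ler_wpDr.
    by apply: sumr_ge0 => i _; rewrite subr_ge0.
  by apply: ler_sum => i; exact: phi_drop.
set X := \sum_(_ | _) _; lra.
Qed.

(** * Rounding and the union bound *)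

Lemma ln_ge_half (R : realType) (n : nat) : (2 <= n)%N -> 1 / 2 <= ln n%:R :> R.
Proof.
move=> n2; have n0 : 0 < n%:R :> R by rewrite ltr0n; lia.
rewrite -ler_expR lnK ?posrE //.
apply: le_trans (@expR_le_quad R (1 / 2) (lexx _)) _.
have : 2 <= n%:R :> R by rewrite ler_nat.
lra.
Qed.

(** The theorem with its fractional powers cleared by cubing; 1000000 is the cube of 100. *)
Lemma essential_cover_cube_bound (R : realType) (n k : nat) (v : 'I_k -> 'I_n -> R)
    (mu : 'I_k -> R) :
  (2 <= n)%N -> essential_cover v mu ->
  (n%:R : R) ^+ 2 <= 1000000%:R * k%:R ^+ 3 * ln n%:R ^+ 2.
Proof.
move=> n2 ec; rewrite leNgt; apply/negP => small.
set l := ln n%:R in small.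
have l12 : 1 / 2 <= l := ln_ge_half R n2.
have n0 : 0 < n%:R :> R by rewrite ltr0n; lia.
have supp i := essential_cover_support i ec.
have [_ [cov [E2 E3]]] := ec.
have k0 : (0 < k)%N.
  by have [i _] := cov [ffun=> true]; apply: leq_ltn_trans (ltn_ord i).
have k1 : 1 <= k%:R :> R by rewrite ler1n.
(* [L] >= 8 ln n and [theta] ^ 2 = 16 ln n are chosen so that exp(-L/4) and exp(-theta^2/8) are at
   most n^-2. *)
pose L := (Num.trunc (8 * l)).+1.
have L1 : 8 * l <= L%:R by apply: ltW; apply: truncnS_gt.
have L2 : L%:R <= 10 * l.
  have : (Num.trunc (8 * l))%:R <= 8 * l by rewrite truncn_le; lra.
  rewrite /L -natr1; lra.
pose theta := Num.sqrt (16 * l).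
have th2 : theta ^+ 2 = 16 * l by rewrite sqr_sqrtr; lra.
have th0 : 0 < theta by rewrite sqrtr_gt0; lra.
(* Squared, the left side is at most 1024 * 160 k^3 l^2, which is below 1000000 k^3 l^2. *)
have light : 32 * #|'I_k|%:R * (theta * (Num.sqrt k%:R * Num.sqrt L%:R)) < #|'I_n|%:R :> R.
  rewrite !card_ord; set z := 32 * _ * _.
  have z0 : 0 <= z by rewrite /z !mulr_ge0 ?sqrtr_ge0 ?ler0n.
  rewrite -(@ltr_pXn2r _ 2) ?nnegrE ?(ltW n0) //; apply: le_lt_trans small.
  rewrite /z !exprMn th2 !sqr_sqrtr ?ler0n //.
  have h : 16 * l * L%:R <= 160 * l ^+ 2 by nra.
  have k3 : 0 <= k%:R ^+ 3 :> R by rewrite exprn_ge0 ?ler0n.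
  have := ler_wpM2l k3 h.
  have -> : 32 ^+ 2 * k%:R ^+ 2 * (16 * l * (k%:R * L%:R)) = 1024 * (k%:R ^+ 3 * (16 * l * L%:R)) :> R.
    by ring.
  have : 0 <= k%:R ^+ 3 * l ^+ 2 by rewrite mulr_ge0 // sqr_ge0.
  move: (k%:R ^+ 3) => K; lra.
have [A [A0 lightA]] := exists_light_coordinates k0 (ltn0Sn _) (ltW th0) supp light.
have /set0Pn[j0 j0A] := A0.
have [i0 i0j0] := E2 j0.
have [f [fi0 fN]] := E3 i0.
pose poor i := (#|scales (v i) A| < L.*2)%N.
pose N i : R := Num.sqrt (\sum_(j in A) v i j ^+ 2).
(* Poor rows are rescaled to norm [theta] on [A], and [m] is the level left for [A] once the other
   coordinates agree with [f]. Rich rows are set to zero, so they do not contribute to [u]. *)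
pose w i j := if poor i && (j \in A) then theta * (v i j / N i) else 0.
pose m i := if poor i then theta * ((mu i - \sum_(j | j \notin A) v i j * pm1 (f j)) / N i) else 0.
have [e eP] := bang_signs w m.
pose u j : R := if j \in A then \sum_i pm1 (e i) * w i j else pm1 (f j).
have wsum j : j \in A -> \sum_i `|w i j| <= 1 / 2.
  move=> jA; apply: le_trans (lightA j jA); rewrite [X in _ <= X]big_mkcond /=.
  apply: ler_sum => i _; rewrite /w jA andbT /poor; case: ifP; rewrite ?normr0 // => _.
  by rewrite !normrM normfV [`|theta|]gtr0_norm // [`|N i|]ger0_norm // sqrtr_ge0.
have wnz i j : w i j != 0 -> j \in A.
  by rewrite /w; case: (j \in A) => //; rewrite andbF eqxx.
have wle i j : w i j != 0 -> `|w i j| <= 1 / 2.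
  move/wnz => jA; apply: le_trans (wsum j jA); rewrite (bigD1 i) //= lerDl.
  by apply: sumr_ge0.
have uA j : j \in A -> `|u j| <= 1 / 2.
  move=> jA; apply: le_trans (wsum j jA); rewrite /u jA.
  apply: le_trans (ler_norm_sum _ _ _) _; apply: ler_sum => i _.
  by rewrite normrM normr_pm1 mul1r.
have u1 j : `|u j| <= 1.
  have [jA|jA] := boolP (j \in A); first by apply: le_trans (uA j jA) _; lra.
  by rewrite /u (negbTE jA) normr_pm1.
have fixed b j : biased_prob u b != 0 -> j \notin A -> b j = f j.
  by move=> pb jA; apply: biased_prob_neq0 pb; rewrite /u (negbTE jA).
have hit i : \sum_(b : {ffun 'I_n -> bool} | \sum_j v i j * pm1 (b j) == mu i)
    biased_prob u b <= expR (- (2 * l)).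
  have [/existsP[j1 /andP[j1A vj1]]|/existsPn nt] := boolP [exists j, (j \in A) && (v i j != 0)];
    last first.
    (* A row vanishing on [A] differs from [i0] and takes the same value at [b] as at [f], which
       only hyperplane [i0] contains: it is hit with probability zero. *)
    rewrite big1 ?expR_ge0 // => b /eqP hb; apply/eqP/negPn/negP => pb.
    have vA j : j \in A -> v i j = 0.
      by move=> jA; have := nt j; rewrite jA negbK => /eqP.
    have ii0 : i != i0.
      by apply: contraNneq i0j0 => <-; rewrite vA.
    apply: (fN i ii0); rewrite /on_hyp -hb; apply: eq_bigr => j _.
    have [jA|jA] := boolP (j \in A); first by rewrite vA // !mul0r.
    by rewrite (fixed b).
  have [pi|ri] := boolP (poor i); last first.
    rewrite /poor -leqNgt in ri.
    have [S [SA lac LS]] := exists_lacunary ri.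
    have SAj j : j \in S -> j \in A by move/fintype.subsetP: SA; apply.
    apply: le_trans (biased_prob_lacunary (mu i) u1 lac (fun j jS => uA j (SAj j jS))) _.
    rewrite ler_expR; have : L%:R <= #|S|%:R :> R by rewrite ler_nat.
    lra.
  have N2 : N i ^+ 2 = \sum_(j in A) v i j ^+ 2.
    by rewrite sqr_sqrtr //; apply: sumr_ge0 => j _; exact: sqr_ge0.
  have N0 : N i != 0.
    rewrite gt_eqF // sqrtr_gt0 (bigD1 j1) //= ltr_pwDl ?exprn_even_gt0 //.
    by apply: sumr_ge0 => j _; exact: sqr_ge0.
  have w2 : \sum_j w i j ^+ 2 = theta ^+ 2.
    transitivity (\sum_(j in A) theta ^+ 2 / N i ^+ 2 * v i j ^+ 2).
      rewrite [RHS]big_mkcond; apply: eq_bigr => j _; rewrite /w pi /=.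
      by case: ifP => _; [field | rewrite expr0n].
    by rewrite -mulr_sumr -N2 mulfVK // expf_neq0.
  apply: (@le_trans _ _ (\sum_(b : {ffun 'I_n -> bool} | \sum_j w i j * pm1 (b j) == m i)
      biased_prob u b)).
    (* For [b] of positive probability, cancelling the coordinates outside [A] turns the equation of
       row [i] into its rescaled form. *)
    rewrite big_mkcond [X in _ <= X]big_mkcond /=; apply: ler_sum => b _.
    have pb0 := biased_prob_ge0 b u1.
    case: ifP => [/eqP hb|_]; last by case: ifP.
    have [->|pb] := eqVneq (biased_prob u b) 0; first by case: ifP.
    suff -> : \sum_j w i j * pm1 (b j) == m i by [].
    apply/eqP; rewrite /m pi -hb (bigID (mem A)) /= [X in _ + X]big1 => [|j jA]; last first.
      by rewrite /w (negbTE jA) andbF mul0r.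
    rewrite addr0 [X in X - _](bigID (mem A)) /=.
    rewrite [X in _ + X - _](eq_bigr (fun j => v i j * pm1 (f j))) => [|j jA]; last first.
      by rewrite (fixed b).
    rewrite addrK mulr_suml mulr_sumr; apply: eq_bigr => j jA.
    by rewrite /w pi jA /=; ring.
  have -> : - (2 * l) = - (\sum_j w i j ^+ 2) / 8 by rewrite w2 th2; field.
  apply: (biased_prob_tail (e := pm1 (e i))) => //.
  - exact: normr_pm1.
  - by move=> j wj; split; [apply: uA; exact: wnz wj|exact: wle].
  - apply: le_trans (eP i) _; rewrite le_eqVlt; apply/orP; left; apply/eqP.
    congr (_ * (_ - _)); apply: eq_bigr => j _.
    have [->|/wnz jA] := eqVneq (w i j) 0; first by rewrite !mul0r.
    by rewrite /u jA.
have : 1 <= \sum_(i < k) expR (- (2 * l)).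
  rewrite -[X in X <= _](sum_biased_prob1 u).
  apply: (@le_trans _ _ (\sum_i \sum_(b : {ffun 'I_n -> bool} |
      \sum_j v i j * pm1 (b j) == mu i) biased_prob u b)); last first.
    by apply: ler_sum => i _; exact: hit.
  under [X in _ <= X]eq_bigr do rewrite big_mkcond /=.
  rewrite exchange_big /=; apply: ler_sum => b _.
  have [i /eqP hi] := cov b; rewrite (bigD1 i) //= hi lerDl.
  by apply: sumr_ge0 => i' _; case: ifP => // _; exact: biased_prob_ge0.
rewrite sumr_const card_ord -[_ *+ k]mulr_natl expRN mulrC.
have -> : expR (2 * l) = n%:R ^+ 2.
  by rewrite expRM_natl lnK.
rewrite ler_pdivlMl ?exprn_gt0 // mulr1 => nk.
(* The union bound gave n^2 <= k; with k <= k^3 and l^2 >= 1/4 this contradicts [small]. *)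
have l2 : 1 / 4 <= l ^+ 2 by nra.
have k3 : k%:R <= k%:R ^+ 3 :> R by rewrite -[X in X <= _]expr1 ler_weXn2l.
have := ler_pM (_ : 0 <= k%:R) (_ : 0 <= 1 / 4) k3 l2.
move=> /(_ (ler0n _ _) _); have q : 0 <= 1 / 4 :> R by lra.
move=> /(_ q); move: small; rewrite -mulrA; set K := k%:R ^+ 3 * _; lra.
Qed.

Theorem mainTheorem1 (R : realType) (n k : nat) (v : 'I_k -> 'I_n -> R)
  (mu : 'I_k -> R) :
  (2 <= n)%N -> essential_cover v mu ->
  (100%:R)^-1 * (n%:R `^ (2%:R / 3%:R)) / ((ln (n%:R : R)) `^ (2%:R / 3%:R))
    <= k%:R.
Proof.
move=> n2 ec; have := essential_cover_cube_bound n2 ec.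
have l12 := ln_ge_half R n2; set l := ln _ in l12 * => H.
(* Cubing turns both 2/3 powers into squares. *)
have cube (x : R) : 0 <= x -> (x `^ (2%:R / 3%:R)) ^+ 3 = x ^+ 2.
  move=> x0; rewrite -powR_mulrn ?powR_ge0 // -powRrM -powR_mulrn //.
  by congr (_ `^ _); field.
have lp : 0 < l `^ (2%:R / 3%:R) by apply: powR_gt0; lra.
rewrite -(@ler_pXn2r _ 3) ?nnegrE ?ler0n //; last first.
  by rewrite divr_ge0 ?mulr_ge0 ?invr_ge0 ?powR_ge0.
rewrite expr_div_n exprMn !cube ?ler0n //; last by lra.
rewrite ler_pdivrMr; last by rewrite exprn_gt0 //; lra.
by move: H; rewrite -mulrA; set K := k%:R ^+ 3 * _; set M := n%:R ^+ 2; lra.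
Qed.
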